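(* The following problem is PSPACE-hard: given a finite set $\Phi$ of simple sequents (sequents $A\Rightarrow B$ with $A,B$ formulas) of $\mathsf{BDFNL^*}$ and a $\mathsf{BDFNL^*}$-sequent $\Gamma\Rightarrow A$, decide whether $\Phi\vdash_{\mathsf{BDFNL^*}}\Gamma\Rightarrow A$.
   Context: Formulas of $\mathsf{BDFNL^*}$ over a set $\mathsf{Prop}$ of propositional letters: $A::=p\mid\top\mid\bot\mid A\wedge B\mid A\vee B\mid A\cdot B\mid A\backslash B\mid A/B$. Formula trees: $\Gamma::=A\mid\Gamma\circ\Delta$; $\Gamma[\Delta]$ denotes a tree with a distinguished occurrence of subtree $\Delta$. Sequents are $\Gamma\Rightarrow A$ with $\Gamma$ a formula tree or empty. $\mathsf{BDFNL^*}$ has axioms (Id) $A\Rightarrow A$; (D) $A\wedge(B\vee C)\Rightarrow(A\wedge B)\vee(A\wedge C)$; ($\bot$) $\Gamma[\bot]\Rightarrow A$; ($\top$) $\Gamma\Rightarrow\top$; and rules: from $\Delta\Rightarrow A$ and $\Gamma[B]\Rightarrow C$ infer $\Gamma[\Delta\circ(A\backslash B)]\Rightarrow C$; from $A\circ\Gamma\Rightarrow B$ infer $\Gamma\Rightarrow A\backslash B$; from $\Gamma[A]\Rightarrow C$ and $\Delta\Rightarrow B$ infer $\Gamma[(A/B)\circ\Delta]\Rightarrow C$; from $\Gamma\circ B\Rightarrow A$ infer $\Gamma\Rightarrow A/B$ (in these two right rules $\Gamma$ may be empty); from $\Gamma[A\circ B]\Rightarrow C$ infer $\Gamma[A\cdot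 B]\Rightarrow C$; from $\Gamma\Rightarrow A$, $\Delta\Rightarrow B$ infer $\Gamma\circ\Delta\Rightarrow A\cdot B$; (Cut) from $\Delta\Rightarrow A$ and $\Gamma[A]\Rightarrow B$ infer $\Gamma[\Delta]\Rightarrow B$; from $\Gamma[A_i]\Rightarrow B$ infer $\Gamma[A_1\wedge A_2]\Rightarrow B$; from $\Gamma\Rightarrow A$, $\Gamma\Rightarrow B$ infer $\Gamma\Rightarrow A\wedge B$; from $\Gamma[A_1]\Rightarrow B$, $\Gamma[A_2]\Rightarrow B$ infer $\Gamma[A_1\vee A_2]\Rightarrow B$; from $\Gamma\Rightarrow A_i$ infer $\Gamma\Rightarrow A_1\vee A_2$. $\Phi\vdash_{\mathsf{BDFNL^*}}\Gamma\Rightarrow A$ means $\Gamma\Rightarrow A$ is derivable using the sequents of $\Phi$ as additional axioms (not closed under substitution). *)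

(* Defs.v *)
From HB Require Import structures.
From Stdlib Require Import BinNums.
From mathcomp Require Import all_boot.
Set Implicit Arguments.
Unset Strict Implicit.
Unset Printing Implicit Defensive.

(* The propositional letters are p_1, p_2, p_3, ..., indexed by [positive]. *)
Inductive formula : Type :=
  | Var of positive
  | Top
  | Bot
  | And of formula & formula
  | Or of formula & formula
  | Prod of formula & formula    (* A . B *)
  | Under of formula & formula   (* Under A B is A \ B *)
  | Over of formula & formula.   (* Over A B is A / B *)

Lemma formula_eq_dec : comparable formula.
Proof. by rewrite /comparable /decidable; do 2!decide equality. Qed.

HB.instance Definition _ := hasDecEq.Build formula (compareP formula_eq_dec).

Inductive tree : Type :=
  | Leaf of formula
  | Node of tree & tree.

(* [None] is the empty antecedent. *)
Definition antecedent : Type := option tree.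

Coercion leaf (A : formula) : antecedent := Some (Leaf A).

(* The empty antecedent is the unit of the structural operation. *)
Definition circ (G D : antecedent) : antecedent :=
  match G, D with
  | None, _ => D
  | _, None => G
  | Some t, Some u => Some (Node t u)
  end.

(* Formula trees with one hole. *)
Inductive context : Type :=
  | Hole
  | CtxL of context & tree
  | CtxR of tree & context.

Fixpoint plug (G : context) (D : antecedent) : antecedent :=
  match G with
  | Hole => D
  | CtxL G' t => circ (plug G' D) (Some t)
  | CtxR t G' => circ (Some t) (plug G' D)
  end.

Definition sequent : Type := antecedent * formula.

Inductive derivable (Phi : sequent -> Prop) : antecedent -> formula -> Prop :=
  | d_ax G A : Phi (G, A) -> derivable Phi G A
  | d_id (A : formula) : derivable Phi A A
  | d_dist A B C :
      derivable Phi (And A (Or B C)) (Or (And A B) (And A C))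
  | d_bot G A : derivable Phi (plug G Bot) A
  | d_top G : derivable Phi G Top
  | d_underL G D (A B : formula) C :
      derivable Phi D A -> derivable Phi (plug G B) C ->
      derivable Phi (plug G (circ D (Under A B))) C
  | d_underR G (A : formula) B :
      derivable Phi (circ A G) B -> derivable Phi G (Under A B)
  | d_overL G D (A B : formula) C :
      derivable Phi (plug G A) C -> derivable Phi D B ->
      derivable Phi (plug G (circ (Over A B) D)) C
  | d_overR G A (B : formula) :
      derivable Phi (circ G B) A -> derivable Phi G (Over A B)
  | d_prodL G (A B : formula) C :
      derivable Phi (plug G (circ A B)) C -> derivable Phi (plug G (Prod A B)) C
  | d_prodR G D A B :
      derivable Phi G A -> derivable Phi D B ->
      derivable Phi (circ G D) (Prod A B)
  | d_cut G D (A : formula) B :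
      derivable Phi D A -> derivable Phi (plug G A) B ->
      derivable Phi (plug G D) B
  | d_andL1 G (A1 A2 : formula) B :
      derivable Phi (plug G A1) B -> derivable Phi (plug G (And A1 A2)) B
  | d_andL2 G (A1 A2 : formula) B :
      derivable Phi (plug G A2) B -> derivable Phi (plug G (And A1 A2)) B
  | d_andR G A B :
      derivable Phi G A -> derivable Phi G B -> derivable Phi G (And A B)
  | d_orL G (A1 A2 : formula) B :
      derivable Phi (plug G A1) B -> derivable Phi (plug G A2) B ->
      derivable Phi (plug G (Or A1 A2)) B
  | d_orR1 G A1 A2 : derivable Phi G A1 -> derivable Phi G (Or A1 A2)
  | d_orR2 G A1 A2 : derivable Phi G A2 -> derivable Phi G (Or A1 A2).

(* A finite set of simple sequents A => B, listed as pairs (A, B), together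
   with an arbitrary sequent. *)
Definition instance : Type := seq (formula * formula) * sequent.

Definition consequence (I : instance) : Prop :=
  derivable
    (fun s => exists2 AB, AB \in I.1 & s = (leaf AB.1, AB.2))
    I.2.1 I.2.2.

Inductive token : Type :=
  | K0 | K1 | Kend
  | Ktop | Kbot | Kand | Kor | Kprod | Kunder | Kover
  | Kcirc | Kempty | Karrow | Kcomma | Kturnstile.

Definition token_code (k : token) : 'I_15 :=
  match k with
  | K0 => @Ordinal 15 0 isT
  | K1 => @Ordinal 15 1 isT
  | Kend => @Ordinal 15 2 isT
  | Ktop => @Ordinal 15 3 isT
  | Kbot => @Ordinal 15 4 isT
  | Kand => @Ordinal 15 5 isT
  | Kor => @Ordinal 15 6 isT
  | Kprod => @Ordinal 15 7 isT
  | Kunder => @Ordinal 15 8 isT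
  | Kover => @Ordinal 15 9 isT
  | Kcirc => @Ordinal 15 10 isT
  | Kempty => @Ordinal 15 11 isT
  | Karrow => @Ordinal 15 12 isT
  | Kcomma => @Ordinal 15 13 isT
  | Kturnstile => @Ordinal 15 14 isT
  end.

Definition token_decode (i : 'I_15) : token :=
  nth K0 [:: K0; K1; Kend; Ktop; Kbot; Kand; Kor; Kprod; Kunder; Kover;
             Kcirc; Kempty; Karrow; Kcomma; Kturnstile] i.

Lemma token_codeK : cancel token_code token_decode.
Proof. by case. Qed.

HB.instance Definition _ := Countable.copy token (can_type token_codeK).
HB.instance Definition _ : isFinite token := CanIsFinite token_codeK.

(* Binary digits, least significant first, followed by a terminator. *)
Fixpoint encode_letter (p : positive) : seq token :=
  match p with
  | xO q => K0 :: encode_letter q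
  | xI q => K1 :: encode_letter q
  | xH => [:: K1; Kend]
  end.

(* Formulas and trees are written in prefix notation. *)
Fixpoint encode_formula (A : formula) : seq token :=
  match A with
  | Var p => encode_letter p
  | Top => [:: Ktop]
  | Bot => [:: Kbot]
  | And B C => Kand :: encode_formula B ++ encode_formula C
  | Or B C => Kor :: encode_formula B ++ encode_formula C
  | Prod B C => Kprod :: encode_formula B ++ encode_formula C
  | Under B C => Kunder :: encode_formula B ++ encode_formula C
  | Over B C => Kover :: encode_formula B ++ encode_formula C
  end.

Fixpoint encode_tree (t : tree) : seq token :=
  match t with
  | Leaf A => encode_formula A
  | Node u v => Kcirc :: encode_tree u ++ encode_tree v
  end.

Definition encode_antecedent (G : antecedent) : seq token :=
  if G is Some t then encode_tree t else [:: Kempty].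

Definition encode_sequent (s : sequent) : seq token :=
  encode_antecedent s.1 ++ Karrow :: encode_formula s.2.

Definition encode_instance (I : instance) : seq token :=
  flatten [seq encode_sequent (leaf AB.1, AB.2) ++ [:: Kcomma] | AB <- I.1]
  ++ Kturnstile :: encode_sequent I.2.

Lemma encode_letter_cat p q s t :
  encode_letter p ++ s = encode_letter q ++ t -> p = q /\ s = t.
Proof.
elim: p q => [p IH|p IH|] [q|q|] //=; rewrite ?cats0.
- by case=> /IH[-> ->].
- by case: p {IH}.
- by case=> /IH[-> ->].
- by case: q.
- by case.
Qed.

Lemma encode_formula_cat A B s t :
  encode_formula A ++ s = encode_formula B ++ t -> A = B /\ s = t.
Proof.
elim: A B s t => [p|||A1 I1 A2 I2|A1 I1 A2 I2|A1 I1 A2 I2|A1 I1 A2 I2|A1 I1 A2 I2]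
  [q|||B1 B2|B1 B2|B1 B2|B1 B2|B1 B2] s t //=;
  first [ by move=> /encode_letter_cat[-> ->] | by case: p | by case: q
        | by case | by case; rewrite -!catA => /I1[-> /I2[-> ->]] ].
Qed.

Lemma encode_tree_cat u v s t :
  encode_tree u ++ s = encode_tree v ++ t -> u = v /\ s = t.
Proof.
elim: u v s t => [A|u1 I1 u2 I2] [B|v1 v2] s t /=.
- by case/encode_formula_cat=> -> ->.
- by case: A => //; case.
- by case: B => //; case.
- by case; rewrite -!catA => /I1[-> /I2[-> ->]].
Qed.

Lemma encode_sequent_cat r r' s t :
  encode_sequent r ++ s = encode_sequent r' ++ t -> r = r' /\ s = t.
Proof.
case: r r' => [[u|] A] [[v|] B]; rewrite /encode_sequent /= -?catA ?cat_cons.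
- by case/encode_tree_cat=> -> [] /encode_formula_cat[-> ->].
- by case: u => // -[] // -[].
- by case: v => // -[] // -[].
- by case=> /encode_formula_cat[-> ->].
Qed.

Lemma encode_instance_inj : injective encode_instance.
Proof.
have turnstile r s t : encode_sequent r ++ s <> Kturnstile :: t.
  by case: r => [[u|] A] //; case: u => // -[] // -[].
have cA (a b c d : seq token) : ((a ++ b) ++ c) ++ d = a ++ b ++ c ++ d.
  by rewrite -!catA.
case=> P r [Q r']; rewrite /encode_instance /=.
elim: P Q => [|[A B] P IH] [|[C D] Q] /=.
- by case=> /(congr1 (cat^~ [::])) /encode_sequent_cat[->].
- by rewrite !cA => E; case: (turnstile _ _ _ (esym E)).
- by rewrite !cA => E; case: (turnstile _ _ _ E).
- rewrite !cA => /encode_sequent_cat[[-> ->]] /= [] /IH.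
  by case=> -> ->.
Qed.

Definition consequence_problem (w : seq token) : Prop :=
  exists2 I : instance, w = encode_instance I & consequence I.

Inductive direction : Type := GoLeft | Stay | GoRight.

(* A tape over [X], with [None] the blank: the cells to the left of the head,
   nearest first, and the cells from the head rightwards.  All cells not listed
   are blank; the listed ones are those visited or initially inscribed. *)
Definition tape (X : Type) : Type := seq (option X) * seq (option X).

Definition tape_read (X : Type) (t : tape X) : option X := head None t.2.

Definition tape_write (X : Type) (a : option X) (t : tape X) : tape X :=
  (t.1, a :: behead t.2).

Definition tape_move (X : Type) (d : direction) (t : tape X) : tape X :=
  match d with
  | GoLeft => (behead t.1, head None t.1 :: t.2)
  | Stay => t
  | GoRight => (tape_read t :: t.1, behead t.2)
  end.

(* The machine has [extra_tapes.+1] tapes, and halts when [trans] is [None]. *)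
Record TM (S : finType) : Type := {
  extra_tapes : nat;
  symbol : finType;
  state : finType;
  start : state;
  accept : pred state;
  trans : state -> {ffun 'I_extra_tapes.+1 -> option symbol} ->
    option (state * {ffun 'I_extra_tapes.+1 -> option symbol * direction});
  input : S -> symbol;
  input_inj : injective input
}.

Definition config (S : finType) (M : TM S) : Type :=
  state M * {ffun 'I_(extra_tapes M).+1 -> tape (symbol M)}.

(* The input is written on tape 0. *)
Definition initial (S : finType) (M : TM S) (x : seq S) : config M :=
  (start M,
   [ffun i => ([::], if i == ord0 then [seq Some (input M a) | a <- x]
                     else [::])]).

Definition next_action (S : finType) (M : TM S) (c : config M) :=
  trans c.1 [ffun i => tape_read (c.2 i)].

Definition halted (S : finType) (M : TM S) (c : config M) : bool := ~~ next_action c.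

Definition step (S : finType) (M : TM S) (c : config M) : config M :=
  if next_action c is Some (q, a) then
    (q, [ffun i => tape_move (a i).2 (tape_write (a i).1 (c.2 i))])
  else c.

Definition run (S : finType) (M : TM S) (n : nat) (x : seq S) : config M :=
  iter n (@step S M) (initial M x).

Definition space (S : finType) (M : TM S) (c : config M) : nat :=
  \sum_i (size (c.2 i).1 + size (c.2 i).2).

(* Up to surrounding blanks, the tape contains exactly the word [w]. *)
Definition tape_holds (X : Type) (t : tape X) (w : seq X) : Prop :=
  exists m n,
    rev t.1 ++ t.2 = nseq m None ++ [seq Some a | a <- w] ++ nseq n None.

Definition PSPACE (S : finType) (L : seq S -> Prop) : Prop :=
  exists (M : TM S) (c d : nat), forall x : seq S,
    (forall n, space (run M n x) <= c * size x ^ d + c) /\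
    (exists n, halted (run M n x) /\ (accept (run M n x).1 <-> L x)).

(* The output is read on the last tape. *)
Definition polytime (S T : finType) (f : seq S -> seq T) : Prop :=
  exists (M : TM S) (output : T -> symbol M) (c d : nat),
    injective output /\
    forall x : seq S, exists n,
      [/\ n <= c * size x ^ d + c,
          halted (run M n x) &
          tape_holds ((run M n x).2 ord_max) (map output (f x))].

(* Polynomial-time many-one reductions. *)
Definition PSPACE_hard (T : finType) (P : seq T -> Prop) : Prop :=
  forall (S : finType) (L : seq S -> Prop), PSPACE L ->
    exists2 f : seq S -> seq T, polytime f & forall x, L x <-> P (f x).

(* Main.v *)
(* A machine [M] deciding [L] within space [c n^d + c] is viewed as a
   one-dimensional automaton: the [j]-th cell collects, for all tapes, the
   symbols at distance [j] to the left and to the right of the head, so that a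
   step of [M] rewrites every cell according to its neighbours and the cell at
   the heads.  For letters [cell j a] ("the [j]-th cell contains [a]") the
   assumptions
     init => cell j a            (the initial configuration),
     cell 0 a /\ cell j b /\ cell (j+1) c /\ cell (j+2) d
          => tick \ cell (j+1) a'  (one step),
     cell 0 a => goal            (for accepting [a]),   tick \ goal => goal
   entail [init => goal] iff [M] accepts: the derivation follows the run
   backwards from the accepting configuration, and a rejecting run yields a
   countermodel among the subsets of a partial groupoid.  Since only
   [init => cell j a] depends on the input letters and all other assumptions
   are uniform in [j], a program with a few counters prints the instance, with
   the position [j] written in unary inside the binary name of a letter. *)

From Stdlib Require Import BinNums.
Require Import Defs.
From mathcomp Require Import all_boot zify.
Set Implicit Arguments.
Unset Strict Implicit.
Unset Printing Implicit Defensive.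

(** * Soundness for powersets of unital relational groupoids *)

Section Soundness.

Variables (W : Type) (unit : W -> Prop) (R : W -> W -> W -> Prop).
Hypothesis unitl : forall y z, (exists2 x, unit x & R x y z) <-> y = z.
Hypothesis unitr : forall x z, (exists2 y, unit y & R x y z) <-> x = z.
Variable V : positive -> W -> Prop.

Fixpoint interp (A : formula) (w : W) : Prop :=
  match A with
  | Var p => V p w
  | Top => True
  | Bot => False
  | And B C => interp B w /\ interp C w
  | Or B C => interp B w \/ interp C w
  | Prod B C => exists x y, [/\ interp B x, interp C y & R x y w]
  | Under B C => forall x z, interp B x -> R x w z -> interp C z
  | Over B C => forall y z, interp C y -> R w y z -> interp B z
  end.

Fixpoint interp_tree (t : tree) (w : W) : Prop :=
  match t with
  | Leaf A => interp A w
  | Node u v => exists x y, [/\ interp_tree u x, interp_tree v y & R x y w]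
  end.

Definition interp_ante (G : antecedent) : W -> Prop :=
  if G is Some t then interp_tree t else unit.

Arguments interp_ante : simpl never.
Arguments circ : simpl never.

(** [circ] erases an empty side, so the cases with [None] are instances of the two unit laws. *)
Lemma interp_circ G D w :
  interp_ante (circ G D) w <->
  exists x y, [/\ interp_ante G x, interp_ante D y & R x y w].
Proof.
rewrite /interp_ante; case: G D => [t|] [u|] //=; split.
- by move=> Hw; have /unitr[y Uy Rwy] := erefl w; exists w, y.
- case=> x [y [Hx Uy Rxy]]; suff <- : x = w by [].
  by apply/unitr; exists y.
- by move=> Hw; have /unitl[x Ux Rxw] := erefl w; exists x, w.
- case=> x [y [Ux Hy Rxy]]; suff <- : y = w by [].
  by apply/unitl; exists x.
- by move=> Hw; have /unitl[x Ux Rxw] := erefl w; exists x, w.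
- case=> x [y [Ux Hy Rxy]]; suff <- : y = w by [].
  by apply/unitl; exists x.
Qed.

Lemma interp_plug G D E :
  (forall w, interp_ante D w -> interp_ante E w) ->
  forall w, interp_ante (plug G D) w -> interp_ante (plug G E) w.
Proof.
move=> DE; elim: G => [|G IH t|t G IH] w /=; first exact: DE.
all: case/interp_circ=> x [y [Hx Hy Rxy]];
  by apply/interp_circ; exists x, y; split=> //; apply: IH.
Qed.

(** The product of sets is existential in both factors and therefore distributes over unions, at any
    depth of the context. *)
Lemma interp_plug_or G A B w :
  interp_ante (plug G (Or A B)) w ->
  interp_ante (plug G A) w \/ interp_ante (plug G B) w.
Proof.
elim: G w => [|G IH t|t G IH] w //=; case/interp_circ=> x [y [Hx Hy Rxy]].
- by case: (IH _ Hx) => H; [left|right]; apply/interp_circ; exists x, y.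
- by case: (IH _ Hy) => H; [left|right]; apply/interp_circ; exists x, y.
Qed.

Lemma interp_plug_bot G w : ~ interp_ante (plug G Bot) w.
Proof.
elim: G w => [|G IH t|t G IH] w /=; first by case.
all: case/interp_circ=> x [y [Hx Hy Rxy]].
- exact: IH Hx.
- exact: IH Hy.
Qed.

(** In a powerset, intersection distributes over union, and [Under] and [Over] are the residuals of
    the complex product. Apart from [d_bot] and [d_orL], the rules acting inside a context reduce to
    monotonicity of [plug]. *)
Lemma soundness (Phi : sequent -> Prop) :
  (forall G A, Phi (G, A) -> forall w, interp_ante G w -> interp A w) ->
  forall G A, derivable Phi G A -> forall w, interp_ante G w -> interp A w.
Proof.
move=> sPhi G A; elim=> {G A}.
- exact: sPhi.
- by [].
- by move=> A B C w /= [HA []]; [left|right].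
- by move=> G A w /interp_plug_bot.
- by [].
- move=> G D A B C _ HD _ HG w Hw; apply: HG; apply: interp_plug Hw => z.
  by case/interp_circ=> x [y [Hx Hy Rxy]]; apply: Hy Rxy; apply: HD.
- move=> G A B _ IH w Hw x z Hx Rx; apply: IH.
  by apply/interp_circ; exists x, w.
- move=> G D A B C _ HG _ HD w Hw; apply: HG; apply: interp_plug Hw => z.
  by case/interp_circ=> x [y [Hx Hy Rxy]]; apply: Hx Rxy; apply: HD.
- move=> G A B _ IH w Hw x z Hx Rx; apply: IH.
  by apply/interp_circ; exists w, x.
- move=> G A B C _ IH w Hw; apply: IH; apply: interp_plug Hw => z //.
- move=> G D A B _ HA _ HB w /interp_circ[x [y [Hx Hy Rxy]]].
  by exists x, y; split=> //; [apply: HA | apply: HB].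
- move=> G D A B _ HD _ HG w Hw; apply: HG; exact: interp_plug Hw.
- by move=> G A1 A2 B _ IH w Hw; apply: IH; apply: interp_plug Hw => z [].
- by move=> G A1 A2 B _ IH w Hw; apply: IH; apply: interp_plug Hw => z [].
- by move=> G A B _ HA _ HB w Hw; split; [apply: HA | apply: HB].
- by move=> G A1 A2 B _ H1 _ H2 w /interp_plug_or[]; [apply: H1 | apply: H2].
- by move=> G A1 A2 _ IH w Hw; left; apply: IH.
- by move=> G A1 A2 _ IH w Hw; right; apply: IH.
Qed.

End Soundness.

(** * Consequence simulates one-dimensional automata *)

Section Automaton.

Variables (A : finType) (F : A -> A -> A -> A -> A) (F0 : A -> A -> A).
Variables (good : pred A) (blank : A).

(** The bits come in the order in which [encode_letter] prints them, so a name can be output from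
    left to right. *)
Definition bits (s : seq bool) : positive :=
  foldr (fun b p => if b then xI p else xO p) xH s.

Lemma bits_inj : injective bits.
Proof. by elim=> [|[] s IH] [|[] t] //= [] /IH->. Qed.

Arguments bits : simpl never.

(** A one-hot code has constant length and each bit is a separate test on [a], so a letter that
    depends on the input can be printed bit by bit. *)
Definition onehot (a : A) : seq bool := [seq b == a | b <- enum A].

Definition cell_code (j : nat) (a : A) : seq bool :=
  nseq j false ++ true :: onehot a.

(** The first [true] ends the unary position; the one-hot entry at [a] then identifies the
    letter. *)
Lemma cell_code_inj i j a b :
  cell_code i a = cell_code j b -> i = j /\ a = b.
Proof.
rewrite /cell_code; elim: i j => [|i IH] [|j] //= [].
  by move/eq_in_map/(_ a); rewrite mem_enum eqxx => /(_ isT)/esym/eqP.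
by case/IH=> -> ->.
Qed.

Definition cell (j : nat) (a : A) : formula := Var (bits (cell_code j a)).
(* Without [true] among their bits, the next three letters differ from all
   cells. *)
Definition tick : formula := Var (bits [::]).
Definition goal : formula := Var (bits [:: false]).
Definition init : formula := Var (bits [:: false; false]).

Definition init_axiom (j : nat) (a : A) : formula * formula :=
  (init, cell j a).

(** Column [N] is to stay blank at all times, so a single assumption can supply the right-hand
    border of every row. *)
Definition border_axiom (j : nat) : formula * formula := (Top, cell j blank).

Definition step_axiom (j : nat) (x : A * A * A * A) : formula * formula :=
  let: (a, b, c, d) := x in
  (And (cell 0 a) (And (cell j b) (And (cell j.+1 c) (cell j.+2 d))),
   Under tick (cell j.+1 (F a b c d))).

Definition step_axioms (j : nat) : seq (formula * formula) :=
  [seq step_axiom j x | x <- enum {: A * A * A * A}].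

Definition closing_axioms : seq (formula * formula) :=
  [seq (And (cell 0 x.1) (cell 1 x.2), Under tick (cell 0 (F0 x.1 x.2)))
     | x <- enum {: A * A}]
  ++ [seq (cell 0 a, goal) | a <- enum good]
  ++ [:: (Under tick goal, goal)].

(* The steps are listed by decreasing [j] because the program printing them
   counts [j] down. *)
Definition automaton_axioms (g : nat -> A) (N : nat) :
    seq (formula * formula) :=
  [seq init_axiom j (g j) | j <- iota 0 N]
  ++ border_axiom N
  :: flatten [seq step_axioms j | j <- rev (iota 0 N.-1)]
  ++ closing_axioms.

Section Run.

Variables (gamma : nat -> nat -> A) (N : nat).
Hypothesis N_gt0 : 0 < N.
Hypothesis gamma0 : forall t, gamma t.+1 0 = F0 (gamma t 0) (gamma t 1).
Hypothesis gammaS : forall t j, gamma t.+1 j.+1 =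
  F (gamma t 0) (gamma t j) (gamma t j.+1) (gamma t j.+2).
Hypothesis gammaN : forall t, gamma t N = blank.

(** * Derivations along an accepting run *)

Let axs := automaton_axioms (gamma 0) N.
Let Phi (s : sequent) := exists2 AB, AB \in axs & s = (leaf AB.1, AB.2).

Let ax B C : (B, C) \in axs -> derivable Phi (leaf B) C.
Proof. by move=> BC; apply: d_ax; exists (B, C). Qed.

Let cut G B C : derivable Phi G B -> derivable Phi (leaf B) C ->
  derivable Phi G C.
Proof. by move=> GB BC; apply: (@d_cut _ Hole G B C). Qed.

Let andL B C D : derivable Phi (leaf B) D -> derivable Phi (leaf (And B C)) D.
Proof. exact: (@d_andL1 _ Hole). Qed.

Let andR B C D : derivable Phi (leaf C) D -> derivable Phi (leaf (And B C)) D.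
Proof. exact: (@d_andL2 _ Hole). Qed.

Let under_tick B C : derivable Phi (leaf B) (Under tick C) ->
  derivable Phi (circ tick B) C.
Proof.
move=> BC; apply: (@d_cut _ (CtxR (Leaf tick) Hole) _ _ _ BC) => /=.
by apply: (@d_underL _ Hole tick tick C); apply: d_id.
Qed.

(** A whole row is one conjunction: [And] is additive, so the same copy of the row serves to derive
    each cell of the next row. *)
Let conf t := foldr (fun j B => And (cell j (gamma t j)) B) Top (iota 0 N.+1).

Let conf_cell t j : j <= N -> derivable Phi (leaf (conf t)) (cell j (gamma t j)).
Proof.
move=> jN; have: j \in iota 0 N.+1 by rewrite mem_iota.
rewrite /conf; elim: (iota 0 _) => //= i s IH.
rewrite inE => /predU1P[->|/IH]; last exact: andR.
exact: andL (d_id _ _).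
Qed.

Let to_conf t G :
  (forall j, j <= N -> derivable Phi G (cell j (gamma t j))) ->
  derivable Phi G (conf t).
Proof.
move=> H; have: {subset iota 0 N.+1 <= fun j => j <= N}.
  by move=> j; rewrite mem_iota.
rewrite /conf; elim: (iota 0 _) => [|i s IH] sN /=; first exact: d_top.
apply: d_andR; first by apply/H/sN; rewrite mem_head.
by apply: IH => j js; apply: sN; rewrite inE js orbT.
Qed.

Let border G : derivable Phi G (cell N blank).
Proof. by apply: cut (d_top _ G) (ax _); rewrite mem_cat inE eqxx orbT. Qed.

Let closing B C : (B, C) \in closing_axioms -> (B, C) \in axs.
Proof. by move=> BC; rewrite mem_cat inE mem_cat BC !orbT. Qed.

Let start : derivable Phi (leaf init) (conf 0).
Proof.
apply: to_conf => j; rewrite leq_eqVlt => /predU1P[->|jN].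
  by rewrite gammaN; apply: border.
apply: ax; rewrite mem_cat; apply/orP; left.
by apply/mapP; exists j; rewrite // mem_iota.
Qed.

Let conf_step t : derivable Phi (circ tick (conf t)) (conf t.+1).
Proof.
apply: to_conf => -[_|j jN].
  rewrite gamma0; apply: under_tick.
  apply: cut (d_andR (conf_cell t (leq0n N)) (conf_cell t N_gt0)) (ax _).
  apply: closing.
  rewrite mem_cat; apply/orP; left.
  by apply/mapP; exists (gamma t 0, gamma t 1); rewrite // mem_enum.
(* The last column is the border; otherwise [j.+2 <= N], and the columns [j], [j.+1] and [j.+2] all
   belong to the row. *)
move: jN; rewrite leq_eqVlt => /predU1P[->|jN].
  by rewrite gammaN; apply: border.
rewrite gammaS; apply: under_tick.
have Hb := @conf_cell t j (ltnW (ltnW jN)).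
have Hc := @conf_cell t j.+1 (ltnW jN); have Hd := @conf_cell t j.+2 jN.
apply: cut (d_andR (conf_cell t (leq0n N)) (d_andR Hb (d_andR Hc Hd))) (ax _).
rewrite mem_cat inE mem_cat; apply/orP; right; apply/orP; right.
apply/orP; left; apply/flattenP; exists (step_axioms j).
  by apply/mapP; exists j; rewrite // mem_rev mem_iota; lia.
by apply/mapP; exists (gamma t 0, gamma t j, gamma t j.+1, gamma t j.+2);
  rewrite // mem_enum.
Qed.

(** Induction backwards from the accepting time: [tick] followed by row [t] yields row [t.+1], hence
    [goal]; [d_underR] moves [tick] to the right, where the axiom [tick \ goal => goal] absorbs
    it. *)
Let conf_goal t k : good (gamma (t + k) 0) -> derivable Phi (leaf (conf t)) goal.
Proof.
elim: k t => [|k IH] t.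
  rewrite addn0 => gt; apply: cut (conf_cell t (leq0n N)) (ax (closing _)).
  rewrite !mem_cat; apply/orP; right; apply/orP; left.
  by apply/mapP; exists (gamma t 0) => //; rewrite mem_enum.
rewrite addnS -addSn => /IH gt.
apply: (@cut _ (Under tick goal)); last first.
  by apply/ax/closing; rewrite !mem_cat inE eqxx !orbT.
by apply: d_underR; apply: cut gt; apply: conf_step.
Qed.

(* The countermodel: the times [At t] of the run, the point [Mu], which acts
   on them from the left as the successor, and the unit [Eps].  Every cell
   formula and the goal hold at [Mu] and [Eps], which makes the axioms
   [Top => cell N blank] and [tick \ goal => goal] valid. *)
Inductive point : Type := Eps | Mu | At of nat.

Let R (x y z : point) : Prop :=
  [\/ x = Eps /\ y = z, y = Eps /\ x = z
    | exists t, [/\ x = Mu, y = At t & z = At t.+1]].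

Let V (p : positive) (w : point) : Prop :=
  match w with
  | At t => p = bits [:: false; false] /\ t = 0
            \/ exists j, p = bits (cell_code j (gamma t j))
  | _ => [\/ p = bits [:: false], p = bits [::] /\ w = Mu
           | exists j a, p = bits (cell_code j a)]
  end.

Let true_cell j a : true \in cell_code j a.
Proof. by rewrite mem_cat inE orbT. Qed.

Let V_cell j a w : interp R V (cell j a) w <->
  if w is At t then gamma t j = a else True.
Proof.
case: w => [||t] /=.
- by split=> // _; constructor 3; exists j, a.
- by split=> // _; constructor 3; exists j, a.
- split=> [[[/bits_inj E _]|[i /bits_inj/cell_code_inj[-> ->]]]|<-] //.
    by have:= true_cell j a; rewrite E.
  by right; exists j.
Qed.

Let V_tick w : interp R V tick w <-> w = Mu.
Proof.
case: w => [||t] /=; split=> //.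
- by case=> [/bits_inj //|[]|[j [a /bits_inj E]]] //;
  have:= true_cell j a; rewrite -E.
- by move=> _; constructor 2.
- by case=> [[/bits_inj //]|[j /bits_inj E]] //;
  have:= true_cell j (gamma t j); rewrite -E.
Qed.

Let V_goal w : interp R V goal w <-> if w is At _ then False else True.
Proof.
case: w => [||t] /=; split=> //.
- by move=> _; constructor 1.
- by move=> _; constructor 1.
- by case=> [[/bits_inj //]|[j /bits_inj E]] //;
  have:= true_cell j (gamma t j); rewrite -E.
Qed.

Let V_init w : interp R V init w <-> w = At 0.
Proof.
case: w => [||t] /=; split=> //.
- by case=> [/bits_inj //|[]|[j [a /bits_inj E]]] //;
  have:= true_cell j a; rewrite -E.
- by case=> [/bits_inj //|[]|[j [a /bits_inj E]]] //;
  have:= true_cell j a; rewrite -E.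
- by case=> [[_ ->]|[j /bits_inj E]] //;
  have:= true_cell j (gamma t j); rewrite -E.
- by case=> ->; left.
Qed.

(** Multiplying by [Mu] on the left sends [Eps] to [Mu] and [At t] to [At t.+1]; there is no product
    of [Mu] with itself, so [tick \ C] holds at [Mu] vacuously. *)
Let V_under w C : (forall t, w = At t -> interp R V C (At t.+1)) ->
  (w = Eps -> interp R V C Mu) -> interp R V (Under tick C) w.
Proof.
move=> Ht He x z /V_tick-> [[]|[wE <-]|[t [_ wE ->]]] //.
  exact: He.
exact: Ht.
Qed.

(** At the times [At t] the step axioms express the recurrence of [gamma]; at [Eps] and [Mu] all
    cells and [goal] are true. *)
Let valid B C : (forall t, ~~ good (gamma t 0)) -> (B, C) \in axs ->
  forall w, interp R V B w -> interp R V C w.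
Proof.
move=> ngood; rewrite mem_cat inE !mem_cat => /or4P[].
- by case/mapP=> j _ [-> ->] w /V_init->; apply/V_cell.
- by case/eqP=> -> -> w _; apply/V_cell; case: w.
- case/flattenP=> _ /mapP[j _ ->] /mapP[[[[a b] c] d] _ [-> ->]] w.
  case=> /V_cell H0 [/V_cell H1 [/V_cell H2 /V_cell H3]].
  apply: V_under => [t wE|_]; apply/V_cell => //.
  by rewrite wE in H0 H1 H2 H3; rewrite gammaS; congr F.
rewrite inE => /or3P[].
- case/mapP=> -[a d] _ [-> ->] w [/V_cell H0 /V_cell H1].
  apply: V_under => [t wE|_]; apply/V_cell => //.
  by rewrite wE in H0 H1; rewrite gamma0; congr F0.
- case/mapP=> a; rewrite mem_enum => ga [-> ->] w /V_cell wa; apply/V_goal.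
  case: w wa => // t wa; have:= ngood t.
  by rewrite wa; move: ga; rewrite unfold_in => ->.
(* At [At t] the premise [tick \ goal] would force [goal] at [At t.+1], where it is false. *)
- case/eqP=> -> -> w Hw; apply/V_goal; case: w Hw => // t.
  move/(_ Mu (At t.+1) (proj2 (V_tick Mu) erefl)) => Hw.
  by apply/(V_goal (At t.+1))/Hw; constructor 3; exists t.
Qed.

Lemma accepting_consequence t : good (gamma t 0) ->
  consequence (automaton_axioms (gamma 0) N, (leaf init, goal)).
Proof. by move=> gt; apply: cut start (conf_goal (k := t) _). Qed.

(** The countermodel, with unit set [eq Eps], satisfies [init] but not [goal] at [At 0]. *)
Lemma rejecting_consequence : (forall t, ~~ good (gamma t 0)) ->
  ~ consequence (automaton_axioms (gamma 0) N, (leaf init, goal)).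
Proof.
move=> ngood der; have: interp R V goal (At 0); last by move/V_goal.
apply: (@soundness point (eq Eps) R _ _ V _ _ _ _ der) => [y z|x z||].
- split=> [[_ <- [[_ ->]|[-> ->]|[t []]]]|->] //.
  by exists Eps => //; constructor 1.
- split=> [[_ <- [[-> ->]|[_ ->]|[t []]]]|->] //.
  by exists Eps => //; constructor 2.
- by move=> G B [[B' C] BC [-> ->]] w; apply: valid.
- by apply/V_init.
Qed.

End Run.

End Automaton.

(** * Turing machines as one-dimensional automata *)

Section Simulation.

Variables (S : finType) (M : TM S).

Let K := (extra_tapes M).+1.
Let bicell : Type := (option (symbol M) * option (symbol M))%type.

(* For each tape the [j]-th cell to the left of the head and the [j]-th cell
   from the head rightwards.  Only the column [0] carries the state, which also
   tells it apart from the other columns. *)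
Definition column : finType :=
  (option (state M) * {ffun 'I_K -> option (symbol M) * option (symbol M)})%type.

Definition column_at (c : config M) (j : nat) : column :=
  (if j == 0 then Some c.1 else None,
   [ffun i => (nth None (c.2 i).1 j, nth None (c.2 i).2 j)]).

Definition blank_column : column := (None, [ffun=> (None, None)]).

Definition column_action (a : column) :=
  if a.1 is Some q then trans q [ffun i => (a.2 i).2] else None.

(** The heads stay at column 0 and the tapes move instead: a left move shifts the left half inwards
    and the right half outwards, a right move does the opposite. *)
Definition move0 (u : option (symbol M) * direction) (b c : bicell) : bicell :=
  match u.2 with
  | GoLeft => (c.1, b.1)
  | Stay => (b.1, u.1)
  | GoRight => (u.1, c.2)
  end.

(** [head] says that [b] is column 0, whose right entry has just been overwritten: on a left move
    the written symbol is shifted out in its place. *)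
Definition moveS (head : bool) (u : option (symbol M) * direction)
    (b c d : bicell) : bicell :=
  match u.2 with
  | GoLeft => (d.1, if head then u.1 else b.2)
  | Stay => c
  | GoRight => (b.1, d.2)
  end.

Definition next_column0 (a b : column) : column :=
  if column_action a is Some (q, u) then
    (Some q, [ffun i => move0 (u i) (a.2 i) (b.2 i)])
  else a.

Definition next_column (a b c d : column) : column :=
  if column_action a is Some (q, u) then
    (None, [ffun i => moveS b.1 (u i) (b.2 i) (c.2 i) (d.2 i)])
  else c.

(** Halting is required as well, since a run may pass through states in [accept] before it halts. *)
Definition accepting_column (a : column) : bool :=
  if a.1 is Some q then accept q && ~~ column_action a else false.

Lemma column_action_at c : column_action (column_at c 0) = next_action c.
Proof.
rewrite /column_action /next_action /=; congr trans.
by apply/ffunP=> i; rewrite !ffunE /= nth0.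
Qed.

Lemma accepting_column_at c :
  accepting_column (column_at c 0) = accept c.1 && halted c.
Proof. by rewrite /accepting_column column_action_at. Qed.

Lemma next_column0_step c :
  column_at (step c) 0 = next_column0 (column_at c 0) (column_at c 1).
Proof.
rewrite /next_column0 column_action_at /step.
case: next_action => [[q u]|] //; congr (_, _); apply/ffunP=> i; rewrite !ffunE.
rewrite /move0 /tape_write /=; case: (u i) => w []; case: (c.2 i) => l r /=;
  by rewrite ?nth_behead ?nth0.
Qed.

Lemma next_column_step c j : column_at (step c) j.+1 =
  next_column (column_at c 0) (column_at c j) (column_at c j.+1)
    (column_at c j.+2).
Proof.
rewrite /next_column column_action_at /step.
case: next_action => [[q u]|] //; congr (_, _); apply/ffunP=> i; rewrite !ffunE.
rewrite /moveS /tape_write /=; case: (u i) => w []; case: (c.2 i) => l r /=;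
  by rewrite ?nth_behead //; case: j => [|j] //=; rewrite ?nth_behead.
Qed.

(** No half-tape lists more than [space c] cells; [0 < j] excludes the column that carries the
    state. *)
Lemma column_at_space c j : 0 < j -> space c <= j -> column_at c j = blank_column.
Proof.
case: j => // j _ cj; congr (_, _); apply/ffunP=> i; rewrite !ffunE.
have: size (c.2 i).1 + size (c.2 i).2 <= j.+1.
  by apply: leq_trans cj; rewrite /space (bigD1 i) //= leq_addr.
by move=> H; rewrite !nth_default //; lia.
Qed.

(** An initial column depends on its position only through [head] and on a single input letter, so
    one pass over the input can print them all. *)
Definition initial_column (head : bool) (o : option S) : column :=
  (if head then Some (start M) else None,
   [ffun i => (None, if i == ord0 then omap (@input S M) o else None)]).

Lemma column_at_initial x j :
  column_at (initial M x) j = initial_column (j == 0) (onth x j).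
Proof.
congr (_, _); apply/ffunP=> i; rewrite !ffunE /= nth_nil; congr (_, _).
case: (i == ord0); last by rewrite nth_nil.
by elim: x j => [|a x IH] [|j] /=.
Qed.

Lemma halted_run n k x : halted (run M n x) -> run M (n + k) x = run M n x.
Proof.
move=> hn; elim: k => [|k IH]; first by rewrite addn0.
rewrite addnS /run iterS -/(run M _ x) IH /step.
by move: hn; rewrite /halted; case: next_action.
Qed.

(** Halted configurations are fixed by [step], so the later of the two equals the earlier. *)
Lemma halted_run_eq m n x :
  halted (run M m x) -> halted (run M n x) -> run M m x = run M n x.
Proof.
move=> hm hn; case: (leqP m n) => [|/ltnW] /subnKC <-.
  by rewrite halted_run.
by rewrite halted_run.
Qed.

End Simulation.

(** * Counter programs and their compilation *)

Section Programs.

Variable S : finType.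

Definition sym : finType := (S + token)%type.
Definition mark : sym := inr K0.

Inductive reg : Type := RI | RJ | RK | RR | RT.

Record store : Type := Store {
  stI : seq sym; stJ : seq sym; stK : seq sym; stR : seq sym; stT : seq sym;
  out : seq token
}.

Definition get (s : store) (r : reg) : seq sym :=
  match r with
  | RI => stI s | RJ => stJ s | RK => stK s | RR => stR s | RT => stT s
  end.

Definition set (s : store) (r : reg) (v : seq sym) : store :=
  let: Store i j k r' t o := s in
  match r with
  | RI => Store v j k r' t o
  | RJ => Store i v k r' t o
  | RK => Store i j v r' t o
  | RR => Store i j k v t o
  | RT => Store i j k r' v o
  end.

Definition put (s : store) (k : token) : store :=
  let: Store i j k' r t o := s in Store i j k' r t (rcons o k).

(* Every register is a stack whose top is under the head of its tape; pushing
   always pushes [mark], and a counter is a stack of marks. *)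
Inductive cmd : Type :=
  | Skip
  | Push of reg
  | Pop of reg
  | Emit of option sym -> token
  | Seq of cmd & cmd
  | While of reg & cmd.

(** The number is the exact count of machine steps of the compiled code: a push moves and then
    writes, and each round of a loop adds one test and one jump back. *)
Inductive exec : cmd -> store -> nat -> store -> Prop :=
  | exec_skip s : exec Skip s 0 s
  | exec_push r s : exec (Push r) s 2 (set s r (mark :: get s r))
  | exec_pop r s : exec (Pop r) s 1 (set s r (behead (get s r)))
  | exec_emit g s : exec (Emit g) s 1 (put s (g (ohead (stI s))))
  | exec_seq c d s m s' n s'' :
      exec c s m s' -> exec d s' n s'' -> exec (Seq c d) s (m + n) s''
  | exec_while0 r c s : get s r = [::] -> exec (While r c) s 1 s
  | exec_whileS r c s m s' n s'' :
      get s r <> [::] -> exec c s m s' -> exec (While r c) s' n s'' ->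
      exec (While r c) s (1 + (m + (1 + n))) s''.

(* [Op i w d] rewrites tape [i] by [w], a function of the symbols read on tape
   [0] and on tape [i]; [Jz i l] jumps to [l] if tape [i] reads a blank. *)
Inductive instr : Type :=
  | Op of 'I_6 & (option sym -> option sym -> option sym) & direction
  | Jz of 'I_6 & nat
  | Goto of nat.

Definition tape_of (r : reg) : 'I_6 :=
  match r with
  | RI => @Ordinal 6 0 isT
  | RJ => @Ordinal 6 1 isT
  | RK => @Ordinal 6 2 isT
  | RR => @Ordinal 6 3 isT
  | RT => @Ordinal 6 4 isT
  end.

(** [p] is the absolute address of the first instruction; a loop exits past its test, its body and
    its [Goto], hence [(size l).+2]. *)
Fixpoint compile (p : nat) (c : cmd) : seq instr :=
  match c with
  | Skip => [::]
  | Push r => [:: Op (tape_of r) (fun _ x => x) GoLeft;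
                  Op (tape_of r) (fun _ _ => Some mark) Stay]
  | Pop r => [:: Op (tape_of r) (fun _ _ => None) GoRight]
  | Emit g => [:: Op ord_max (fun x _ => Some (inr (g x))) GoRight]
  | Seq c d =>
      let l := compile p c in l ++ compile (p + size l) d
  | While r c =>
      let l := compile p.+1 c in
      Jz (tape_of r) (p + (size l).+2) :: rcons l (Goto p)
  end.

(** The state is the program counter; the value [size code] addresses no instruction and halts. *)
Definition instr_trans (code : seq instr) (q : 'I_(size code).+1)
    (rd : {ffun 'I_6 -> option sym}) :
    option ('I_(size code).+1 * {ffun 'I_6 -> option sym * direction}) :=
  let idle := [ffun i => (rd i, Stay)] in
  omap (fun ins => match ins with
    | Op i w d =>
        (inord q.+1,
         [ffun k => if k == i then (w (rd ord0) (rd i), d) else (rd k, Stay)])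
    | Jz i l => (inord (if rd i is None then l else q.+1), idle)
    | Goto l => (inord l, idle)
    end) (onth code q).

Lemma inl_inj : injective (inl : S -> sym).
Proof. by move=> a b []. Qed.

Definition machine (code : seq instr) : TM S :=
  {| start := ord0 : 'I_(size code).+1; accept := xpredT;
     trans := @instr_trans code; input_inj := inl_inj |}.

(** The cells to the left of a register's head are unconstrained, because [Push] overwrites the one
    it enters. A blank under the head means an empty stack. *)
Definition holds (s : store) (f : {ffun 'I_6 -> tape sym}) : Prop :=
  [/\ forall r, nth None (f (tape_of r)).2 =1 onth (get s r),
      (f ord_max).1 = rev [seq Some (inr k) | k <- out s]
    & forall k, nth None (f ord_max).2 k = None].

(** Rewriting the symbol just read may list an extra blank, so tapes are compared cell by cell and
    not as lists. *)
Lemma nth_rewrite (X : Type) (t : tape X) :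
  nth None (tape_read t :: behead t.2) =1 nth None t.2.
Proof. by case: t => l [|a r] [|k] //=; rewrite ?nth_nil. Qed.

Lemma tape_of_max r : (tape_of r == ord_max) = false.
Proof. by case: r. Qed.

Lemma max_tape_of r : (ord_max == tape_of r) = false.
Proof. by case: r. Qed.

Lemma tape_of_inj r r' : tape_of r = tape_of r' -> r = r'.
Proof. by move/(congr1 val); case: r; case: r'. Qed.

Lemma get_set s r v : get (set s r v) r = v.
Proof. by case: s r => ? ? ? ? ? ? []. Qed.

Lemma get_set_neq s r r' v : (tape_of r == tape_of r') = false ->
  get (set s r' v) r = get s r.
Proof. by case: s => ? ? ? ? ? ?; case: r; case: r'. Qed.

Lemma out_set s r v : out (set s r v) = out s.
Proof. by case: s r => ? ? ? ? ? ? []. Qed.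

Section Steps.

Variables (code : seq instr) (c : config (machine code)) (s : store).

Lemma step_op i w d : onth code (val c.1) = Some (Op i w d) ->
  val (step c).1 = (val c.1).+1 /\
  forall k, (step c).2 k =
    if k == i
    then tape_move d (tape_write
           (w (tape_read (c.2 (tape_of RI))) (tape_read (c.2 i))) (c.2 i))
    else tape_write (tape_read (c.2 k)) (c.2 k).
Proof.
move=> E; rewrite /step /next_action /= /instr_trans /= E /=; split.
  by rewrite inordK // ltnS -onthTE E.
move=> k; rewrite !ffunE; case: eqP => [->|_] //=.
by have <- : tape_of RI = ord0 by apply: val_inj.
Qed.

Hypothesis cs : holds s c.2.

Lemma read_reg r : tape_read (c.2 (tape_of r)) = ohead (get s r).
Proof.
by rewrite /tape_read -nth0; case: cs => -> _ _; case: (get s r).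
Qed.

Lemma holds_idle (f : {ffun 'I_6 -> tape sym}) :
  (forall k, f k = tape_write (tape_read (c.2 k)) (c.2 k)) -> holds s f.
Proof.
move=> fE; case: cs => H1 H2 H3; split=> [r k||k]; rewrite fE //=.
- by rewrite nth_rewrite H1.
- by rewrite nth_rewrite H3.
Qed.

Lemma step_jump l i : onth code (val c.1) = Some (Jz i l) -> l <= size code ->
  val (step c).1 = (if tape_read (c.2 i) is None then l else (val c.1).+1)
  /\ holds s (step c).2.
Proof.
move=> E ls; rewrite /step /next_action /= /instr_trans /= E /=; split.
  by rewrite ffunE inordK //; case: tape_read => *; rewrite ltnS // -onthTE E.
by apply: holds_idle => k; rewrite !ffunE.
Qed.

Lemma step_goto l : onth code (val c.1) = Some (Goto l) -> l <= size code ->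
  val (step c).1 = l /\ holds s (step c).2.
Proof.
move=> E ls; rewrite /step /next_action /= /instr_trans /= E /=; split.
  by rewrite inordK.
by apply: holds_idle => k; rewrite !ffunE.
Qed.

End Steps.

Lemma onth_cat_size (X : Type) (l1 l2 : seq X) k :
  onth (l1 ++ l2) (size l1 + k) = onth l2 k.
Proof. by elim: l1. Qed.

(** Induction on the execution, for code placed at any address, so that the absolute jump targets of
    nested commands are right. *)
Lemma compile_correct c s n s' : exec c s n s' ->
  forall code pre post, code = pre ++ compile (size pre) c ++ post ->
  forall x : config (machine code), val x.1 = size pre -> holds s x.2 ->
  val (iter n (@step S (machine code)) x).1
    = size pre + size (compile (size pre) c)
  /\ holds s' (iter n (@step S (machine code)) x).2.
Proof.
elim=> {c s n s'}.
- by move=> s code pre post _ x xp xs; rewrite /= addn0.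
- move=> r s code pre post codeE x xp xs.
  have E0 : onth code (val x.1) = Some (Op (tape_of r) (fun _ y => y) GoLeft).
    by rewrite xp codeE -[size pre]addn0 onth_cat_size.
  have [p1 f1] := step_op E0.
  set y := step x in p1 f1 *.
  have E1 : onth code (val y.1)
    = Some (Op (tape_of r) (fun _ _ => Some mark) Stay).
    by rewrite p1 xp codeE -addn1 onth_cat_size.
  have ys : forall r', (tape_of r' == tape_of r) = false ->
      nth None (y.2 (tape_of r')).2 =1 onth (get s r').
    by move=> r' rr' k; rewrite f1 rr' /= nth_rewrite; case: xs => ->.
  have [p2 f2] := step_op E1; rewrite /= -/y p2 p1 xp addn2; split=> //.
  case: xs => H1 H2 H3; split=> [r' k||k]; rewrite f2.
  + case: eqVneq => [/tape_of_inj->|/negbTE rr'] /=.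
      rewrite get_set f1 eqxx; case: k => //= k.
      by rewrite nth_rewrite H1.
    by rewrite nth_rewrite ys // get_set_neq.
  + by rewrite max_tape_of /= f1 max_tape_of /= out_set.
  + by rewrite max_tape_of /= nth_rewrite f1 max_tape_of /= nth_rewrite.
- move=> r s code pre post codeE x xp xs.
  have E0 : onth code (val x.1)
    = Some (Op (tape_of r) (fun _ _ => None) GoRight).
    by rewrite xp codeE -[size pre]addn0 onth_cat_size.
  have [p1 f1] := step_op E0; rewrite /= p1 xp addn1; split=> //.
  case: xs => H1 H2 H3; split=> [r' k||k]; rewrite f1.
  + case: eqVneq => [/tape_of_inj->|/negbTE rr'] /=.
      by rewrite get_set nth_behead H1; case: (get s r) => //=; case: k.
    by rewrite nth_rewrite H1 get_set_neq.
  + by rewrite max_tape_of /= out_set.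
  + by rewrite max_tape_of /= nth_rewrite.
- move=> g s code pre post codeE x xp xs.
  have E0 : onth code (val x.1)
      = Some (Op ord_max (fun x _ => Some (inr (g x))) GoRight).
    by rewrite xp codeE -[size pre]addn0 onth_cat_size.
  have [p1 f1] := step_op E0; rewrite /= p1 xp addn1; split=> //.
  rewrite (read_reg xs RI) in f1.
  case: xs => H1 H2 H3; split=> [r' k||k]; rewrite f1.
  + rewrite tape_of_max /= nth_rewrite H1; congr (onth _ k).
    by case: (s) r' => ? ? ? ? ? ? [].
  + by rewrite eqxx /= H2; case: (s) => * /=; rewrite map_rcons rev_rcons.
  + by rewrite eqxx /= nth_behead H3.
- move=> c d s m s' n s'' _ IHc _ IHd code pre post codeE x xp xs.
  rewrite addnC iterD.
  have [] := IHc code pre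
    (compile (size pre + size (compile (size pre) c)) d ++ post) _ x xp xs.
    by rewrite codeE /= -catA.
  set y := iter m _ x => yp ys.
  have [] := IHd code (pre ++ compile (size pre) c) post _ y _ ys.
  + by rewrite codeE size_cat /= -!catA.
  + by rewrite size_cat.
  by rewrite /= !size_cat addnA.
- move=> r c s sr code pre post codeE x xp xs /=.
  have E0 : onth code (val x.1) =
      Some (Jz (tape_of r) (size pre + (size (compile (size pre).+1 c)).+2)).
    by rewrite xp codeE -[size pre]addn0 onth_cat_size /= addn0.
  have [|p1 x1] := step_jump xs E0.
    by rewrite codeE !size_cat /= size_rcons; lia.
  split=> //; rewrite p1 size_rcons.
  by rewrite /tape_read -nth0; case: (xs) => ->; rewrite sr.
- move=> r c s m s' n s'' sr _ IHc _ IHw code pre post codeE x xp xs.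
  have E0 : onth code (val x.1) =
      Some (Jz (tape_of r) (size pre + (size (compile (size pre).+1 c)).+2)).
    by rewrite xp codeE -[size pre]addn0 onth_cat_size /= addn0.
  have [|p1 x1] := step_jump xs E0.
    by rewrite codeE !size_cat /= size_rcons; lia.
  (* The run splits into the test, the body, the jump back and the remaining rounds. *)
  rewrite [1 + (m + _)]addnC iterD addnC iterD [1 + n]addnC iterD /=.
  set y := step x in p1 x1 *; set z := iter m _ y.
  set ins := Jz _ _ in E0; set l := compile (size pre).+1 c in ins E0 *.
  have p1' : val y.1 = (size pre).+1.
    rewrite p1 /tape_read -nth0; case: (xs) => -> _ _; rewrite xp.
    by case: (get s r) sr.
  have [|||zp zs] := IHc code (rcons pre ins) (Goto (size pre) :: post) _ y.
  + by rewrite size_rcons codeE /= cat_rcons -/l -/ins cat_rcons.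
  + by rewrite size_rcons.
  + by [].
  rewrite -/z size_rcons -/l in zp zs.
  have E1 : onth code (val z.1) = Some (Goto (size pre)).
    rewrite zp codeE addSn -addnS onth_cat_size /= -/l cat_rcons.
    by rewrite -[size l]addn0 onth_cat_size.
  have [|p2 z2] := step_goto zs E1; first by rewrite codeE size_cat leq_addr.
  by have := IHw code pre post codeE (step z) p2 z2.
Qed.

Lemma machine_run e x n s :
  exec e (Store [seq inl a | a <- x] [::] [::] [::] [::] [::]) n s ->
  let c := run (machine (compile 0 e)) n x in
  halted c /\ tape_holds (c.2 ord_max) [seq inr k | k <- out s].
Proof.
move=> ex c.
have [] := compile_correct (pre := [::]) (post := [::]) ex (esym (cats0 _))
  (x := initial (machine (compile 0 e)) x).
- by [].
- split=> [r k||k]; rewrite !ffunE /=.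
  + by case: r => /=; rewrite ?onth0n ?nth_nil // onthE -map_comp.
  + by [].
  + by rewrite nth_nil.
rewrite -/c add0n => pcE [_ outE tailE]; split.
  rewrite /halted /next_action /= /instr_trans.
  suff -> : onth (compile 0 e) (val c.1) = None by [].
  by apply: onth_default; rewrite pcE.
(* The output ends just before the head, and every cell listed from the head on is blank. *)
exists 0, (size (c.2 ord_max).2); rewrite outE revK -map_comp.
congr (_ ++ _); apply: (@eq_from_nth _ None) => [|k _].
  by rewrite size_nseq.
by rewrite tailE nth_nseq if_same.
Qed.

End Programs.

(** * Polynomial bounds and running times *)

(** The base is at least 2 even for [n = 0], so constants and sums are absorbed by raising the
    exponent. *)
Definition poly (f : nat -> nat) : Prop := exists k, forall n, f n <= n.+2 ^ k.

Lemma poly_le f g : (forall n, f n <= g n) -> poly g -> poly f.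
Proof. by move=> fg [k gk]; exists k => n; apply: leq_trans (fg n) (gk n). Qed.

Lemma poly_const c : poly (fun=> c).
Proof.
by exists c => n; apply/ltnW/ltn_expl.
Qed.

Lemma poly_id : poly id.
Proof. by exists 1 => n; rewrite expn1; lia. Qed.

Lemma poly_add f g : poly f -> poly g -> poly (fun n => f n + g n).
Proof.
(* The additional factor [n.+2 >= 2] pays for adding two terms bounded by [n.+2 ^ (k + l)]. *)
move=> [k fk] [l gl]; exists (k + l).+1 => n.
have Hk : n.+2 ^ k <= n.+2 ^ (k + l) by rewrite leq_pexp2l ?leq_addr.
have Hl : n.+2 ^ l <= n.+2 ^ (k + l) by rewrite leq_pexp2l ?leq_addl.
have := fk n; have := gl n; rewrite expnS mulSn mulSn.
move: Hk Hl; set a := _ ^ _; set b := _ ^ _; set u := _ ^ _; nia.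
Qed.

Lemma poly_mul f g : poly f -> poly g -> poly (fun n => f n * g n).
Proof.
by move=> [k fk] [l gl]; exists (k + l) => n; rewrite expnD leq_mul.
Qed.

Lemma poly_exp f d : poly f -> poly (fun n => f n ^ d).
Proof.
by move=> [k fk]; exists (k * d) => n; rewrite expnM; case: d => // d;
  rewrite leq_exp2r.
Qed.

Lemma poly_succ f : poly f -> poly (fun n => (f n).+1).
Proof.
by move=> /poly_add/(_ (poly_const 1)); apply: poly_le => n; rewrite addn1.
Qed.

Lemma poly_sum d (f : nat -> nat -> nat) :
  (forall k, poly (f k)) -> poly (fun n => \sum_(k < d) f k n).
Proof.
move=> fp; elim: d => [|d IH].
  by apply: poly_le (poly_const 0) => n; rewrite big_ord0.
by apply: poly_le (poly_add IH (fp d)) => n; rewrite big_ord_recr.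
Qed.

Lemma poly_bound f : poly f -> exists c d, forall n, f n <= c * n ^ d + c.
Proof.
(* For positive [n] one has [n + 2 <= 3 * n]; at [n = 0] the additive constant covers [2 ^ k]. *)
case=> k fk; exists (3 ^ k), k => n; apply: leq_trans (fk n) _.
case: n => [|n].
  apply: leq_trans (leq_addl _ _); case: k {fk} => // k; by rewrite leq_exp2r.
apply: leq_trans (leq_addr _ _); rewrite -expnMn.
by case: k {fk} => // k; rewrite leq_exp2r //; lia.
Qed.

Ltac polyb := repeat first
  [ exact: poly_id | exact: poly_const | assumption | apply: poly_exp
  | apply: poly_mul | apply: poly_add | apply: poly_succ ].

Section Costs.

Variable S : finType.
Notation cmd := (cmd S).
Notation store := (store S).
Notation mark := (mark S).
Notation sym := (sym S).

Definition exec_le (c : cmd) (s s' : store) (B : nat) : Prop :=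
  exists2 n, n <= B & exec c s n s'.

Lemma exec_le_seq c d s s' s'' m n :
  exec_le c s s' m -> exec_le d s' s'' n -> exec_le (Seq c d) s s'' (m + n).
Proof.
by move=> [m' le_m cs] [n' le_n ds]; exists (m' + n');
  [apply: leq_add | apply: exec_seq cs ds].
Qed.

Lemma exec_le_leq (e : cmd) s s' m n : exec_le e s s' m -> m <= n ->
  exec_le e s s' n.
Proof. by move=> [k km ek] mn; exists k; rewrite // (leq_trans km). Qed.

(** [sigma k] is the loop invariant with [k] rounds left; a round costs its body, a test and a jump,
    and one test remains at the end. *)
Lemma exec_le_while r c (sigma : nat -> store) n B :
  (forall k, k <= n -> size (get (sigma k) r) = k) ->
  (forall k, k < n -> exec_le c (sigma k.+1) (sigma k) B) ->
  exec_le (While r c) (sigma n) (sigma 0) (n * B.+2).+1.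
Proof.
elim: n => [|n IH] sz body.
  by exists 1 => //; apply/exec_while0/size0nil/sz.
have [m mB cm] := body n (ltnSn n).
have [||t tB ct] := IH; first by move=> k kn; apply: sz; apply: leqW.
  by move=> k kn; apply: body; apply: leqW.
exists (1 + (m + (1 + t))); first by lia.
apply: exec_whileS cm ct => E.
by have := sz _ (leqnn n.+1); rewrite E.
Qed.

(** The same rule with [sigma] indexed by the rounds already done. *)
Lemma exec_le_while_up r c (sigma : nat -> store) n B :
  (forall k, k <= n -> size (get (sigma k) r) = n - k) ->
  (forall k, k < n -> exec_le c (sigma k) (sigma k.+1) B) ->
  exec_le (While r c) (sigma 0) (sigma n) (n * B.+2).+1.
Proof.
move=> sz body; have := @exec_le_while r c (fun k => sigma (n - k)) n B.
rewrite subnn subn0; apply=> k kn; first by rewrite sz ?leq_subr // subKn.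
by have := body (n - k.+1); rewrite subnSK //; apply; lia.
Qed.

(** * Printing text that depends on a counter *)

Definition counts (i : seq sym) (j k r t : nat) (o : seq token) : store :=
  Store i (nseq j mark) (nseq k mark) (nseq r mark) (nseq t mark) o.

Definition template : Type := seq (option (option sym -> token)).

(* [None] stands for the value of the register [RJ] in unary. *)
Definition instantiate (j : nat) (a : option sym) (l : template) : seq token :=
  flatten [seq if e is Some g then [:: g a] else nseq j K0 | e <- l].

(** Reading a counter destroys it, so its value is saved in [RK] while printing and then moved
    back. *)
Definition emit_unary : cmd :=
  Seq (While RJ (Seq (Pop _ RJ) (Seq (Push _ RK) (Emit (fun=> K0)))))
      (While RK (Seq (Pop _ RK) (Push _ RJ))).

Definition emit_template (l : template) : cmd :=
  foldr (fun e => Seq (if e is Some g then Emit g else emit_unary)) (Skip _) l.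

Lemma exec_le_one c s s' : exec c s 1 s' -> exec_le c s s' 1.
Proof. by exists 1. Qed.

Lemma exec_le_two c s s' : exec c s 2 s' -> exec_le c s s' 2.
Proof. by exists 2. Qed.

Lemma exec_emit_unary i j r t o :
  exec_le emit_unary (counts i j 0 r t o)
    (counts i j 0 r t (o ++ nseq j K0)) (11 * j + 2).
Proof.
(* Rounds of the two loops cost 4 + 2 and 3 + 2 steps, and each loop has a final test. *)
have -> : 11 * j + 2 = (j * 6).+1 + (j * 5).+1 by lia.
apply: (@exec_le_seq _ _ _ (counts i 0 j r t (o ++ nseq j K0))).
  pose sigma k := counts i (j - k) k r t (o ++ nseq k K0).
  have := @exec_le_while_up RJ _ sigma j 4 _ _.
  rewrite /sigma subn0 subnn cats0; apply=> k kj; first by rewrite size_nseq.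
  apply: (@exec_le_seq _ _ _
    (counts i (j - k.+1) k r t (o ++ nseq k K0)) _ 1 3).
    by apply: exec_le_one; rewrite -(subnSK kj); apply: exec_pop.
  apply: (@exec_le_seq _ _ _
    (counts i (j - k.+1) k.+1 r t (o ++ nseq k K0)) _ 2 1).
    exact: (exec_le_two (exec_push RK _)).
  apply: exec_le_one; have -> : o ++ nseq k.+1 K0 = rcons (o ++ nseq k K0) K0.
    by rewrite -addn1 nseqD catA cats1.
  by apply: (exec_emit _ (counts _ _ _ _ _ _)).
pose sigma k := counts i (j - k) k r t (o ++ nseq j K0).
have := @exec_le_while RK _ sigma j 3 _ _.
rewrite /sigma subn0 subnn; apply=> k kj; first by rewrite size_nseq.
apply: (@exec_le_seq _ _ _ (counts i (j - k.+1) k r t (o ++ nseq j K0)) _ 1 2).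
  exact: (exec_le_one (exec_pop RK _)).
by rewrite -(subnSK kj); apply: (exec_le_two (exec_push RJ _)).
Qed.

Lemma exec_emit_template l i j r t o :
  exec_le (emit_template l) (counts i j 0 r t o)
    (counts i j 0 r t (o ++ instantiate j (ohead i) l)) (size l * (11 * j + 2)).
Proof.
elim: l o => [|e l IH] o; first by exists 0; rewrite // cats0; apply: exec_skip.
rewrite mulSn /= /instantiate /= catA; apply: exec_le_seq (IH _).
case: e => [g|]; last exact: exec_emit_unary.
exists 1; first by lia.
by rewrite cats1; apply: (exec_emit _ (counts _ _ _ _ _ _)).
Qed.

Lemma instantiate_cat j a l l' :
  instantiate j a (l ++ l') = instantiate j a l ++ instantiate j a l'.
Proof. by rewrite /instantiate map_cat flatten_cat. Qed.

Lemma instantiate_flatten j a (ls : seq template) :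
  instantiate j a (flatten ls) = flatten [seq instantiate j a l | l <- ls].
Proof. by elim: ls => //= l ls <-; rewrite instantiate_cat. Qed.

Definition text (w : seq token) : template := [seq Some (fun=> k) | k <- w].

Lemma instantiate_text j a w : instantiate j a (text w) = w.
Proof. by rewrite /instantiate /text -map_comp; elim: w => //= k w ->. Qed.

(** Replaces [RR] by its product with [RJ]: the product accumulates in [RT], and [RK] restores [RJ]
    after each addition. *)
Definition multiply : cmd :=
  Seq (While RR (Seq (Pop _ RR)
        (Seq (While RJ (Seq (Pop _ RJ) (Seq (Push _ RK) (Push _ RT))))
             (While RK (Seq (Pop _ RK) (Push _ RJ))))))
      (While RT (Seq (Pop _ RT) (Push _ RR))).

Lemma exec_move_TR i j k r t o :
  exec_le (While RT (Seq (Pop _ RT) (Push _ RR))) (counts i j k r t o)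
    (counts i j k (r + t) 0 o) (t * 5).+1.
Proof.
pose sigma l := counts i j k (r + (t - l)) l o.
have := @exec_le_while RT _ sigma t 3 _ _.
rewrite /sigma subn0 subnn addn0; apply=> l lt; first by rewrite size_nseq.
apply: (@exec_le_seq _ _ _ (counts i j k (r + (t - l.+1)) l o) _ 1 2).
  exact: (exec_le_one (exec_pop RT _)).
rewrite -(subnSK lt) addnS; exact: (exec_le_two (exec_push RR _)).
Qed.

Lemma exec_multiply i j r o :
  exec_le multiply (counts i j 0 r 0 o) (counts i j 0 (r * j) 0 o)
    ((r * (j * 12 + 5)).+1 + (r * j * 5).+1).
Proof.
apply: exec_le_seq; last exact: (@exec_move_TR i j 0 0 (r * j) o).
pose sigma k := counts i j 0 (r - k) (k * j) o.
have := @exec_le_while_up RR _ sigma r (j * 12 + 3) _ _.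
rewrite /sigma subn0 subnn -!addnS; apply=> k kr; first by rewrite size_nseq.
have -> : j * 12 + 3 = 1 + ((j * 7).+1 + (j * 5).+1) by lia.
apply: (@exec_le_seq _ _ _ (counts i j 0 (r - k.+1) (k * j) o)).
  by rewrite -(subnSK kr); apply: (exec_le_one (exec_pop RR _)).
apply: (@exec_le_seq _ _ _ (counts i 0 j (r - k.+1) (k.+1 * j) o)).
  pose tau l := counts i (j - l) l (r - k.+1) (k * j + l) o.
  have := @exec_le_while_up RJ _ tau j 5 _ _.
  rewrite /tau subn0 subnn addn0 [k * j + j]addnC -mulSn.
  apply=> l lj; first by rewrite size_nseq.
  apply: (@exec_le_seq _ _ _
    (counts i (j - l.+1) l (r - k.+1) (k * j + l) o) _ 1 4).
    by rewrite -(subnSK lj); apply: (exec_le_one (exec_pop RJ _)).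
  apply: (@exec_le_seq _ _ _
    (counts i (j - l.+1) l.+1 (r - k.+1) (k * j + l) o) _ 2 2).
    exact: (exec_le_two (exec_push RK _)).
  by rewrite addnS; apply: (exec_le_two (exec_push RT _)).
pose tau l := counts i (j - l) l (r - k.+1) (k.+1 * j) o.
have := @exec_le_while RK _ tau j 3 _ _.
rewrite /tau subn0 subnn; apply=> l lj; first by rewrite size_nseq.
apply: (@exec_le_seq _ _ _ (counts i (j - l.+1) l (r - k.+1) (k.+1 * j) o) _ 1 2).
  exact: (exec_le_one (exec_pop RK _)).
by rewrite -(subnSK lj); apply: (exec_le_two (exec_push RJ _)).
Qed.

Definition repeat_cmd (n : nat) (c : cmd) : cmd := iter n (Seq c) (Skip _).

Lemma exec_repeat n c (sigma : nat -> store) (B : nat -> nat) :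
  (forall k, k < n -> exec_le c (sigma k) (sigma k.+1) (B k)) ->
  exec_le (repeat_cmd n c) (sigma 0) (sigma n) (\sum_(k < n) B k).
Proof.
elim: n sigma B => [|n IH] sigma B body.
  by exists 0; rewrite // ; apply: exec_skip.
rewrite big_ord_recl; apply: exec_le_seq (body 0 isT) _.
by apply: (IH (fun k => sigma k.+1) (fun k => B k.+1)) => k; exact: (body k.+1).
Qed.

Lemma exec_repeat_push_RR n i j k r t o :
  exec_le (repeat_cmd n (Push _ RR)) (counts i j k r t o)
    (counts i j k (n + r) t o) (n * 2).
Proof.
have -> : n * 2 = \sum_(l < n) 2 by rewrite big_const_ord iter_addn_0 mulnC.
by apply: (@exec_repeat n _ (fun l => counts i j k (l + r) t o) (fun=> 2)) => l _;
  apply: (exec_le_two (exec_push RR _)).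
Qed.

Lemma exec_repeat_push_RT n i j k r t o :
  exec_le (repeat_cmd n (Push _ RT)) (counts i j k r t o)
    (counts i j k r (n + t) o) (n * 2).
Proof.
have -> : n * 2 = \sum_(l < n) 2 by rewrite big_const_ord iter_addn_0 mulnC.
by apply: (@exec_repeat n _ (fun l => counts i j k r (l + t) o) (fun=> 2)) => l _;
  apply: (exec_le_two (exec_push RT _)).
Qed.

(* From [n] in register [RJ], computes [c * n ^ d + c] in register [RR]. *)
Definition compute_space (c d : nat) : cmd :=
  Seq (Push _ RR) (Seq (repeat_cmd d multiply)
    (Seq (While RR (Seq (Pop _ RR) (repeat_cmd c (Push _ RT))))
      (Seq (While RT (Seq (Pop _ RT) (Push _ RR)))
           (repeat_cmd c (Push _ RR))))).

Definition compute_space_time (c d j : nat) : nat :=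
  2 + (\sum_(k < d) ((j ^ k * (j * 12 + 5)).+1 + (j ^ k * j * 5).+1)
    + ((j ^ d * (c * 2 + 3)).+1 + ((c * j ^ d * 5).+1 + c * 2))).

Lemma exec_compute_space c d i j o :
  exec_le (compute_space c d) (counts i j 0 0 0 o)
    (counts i j 0 (c * j ^ d + c) 0 o) (compute_space_time c d j).
Proof.
apply: (@exec_le_seq _ _ _ (counts i j 0 1 0 o)).
  exact: (exec_le_two (exec_push RR _)).
apply: (@exec_le_seq _ _ _ (counts i j 0 (j ^ d) 0 o)).
  apply: (@exec_repeat d _ (fun k => counts i j 0 (j ^ k) 0 o)
    (fun k => (j ^ k * (j * 12 + 5)).+1 + (j ^ k * j * 5).+1)) => k _.
  by rewrite expnSr; apply: exec_multiply.
apply: (@exec_le_seq _ _ _ (counts i j 0 0 (c * j ^ d) o)).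
  pose sigma l := counts i j 0 (j ^ d - l) (c * l) o.
  have := @exec_le_while_up RR _ sigma (j ^ d) (c * 2).+1 _ _.
  rewrite /sigma subn0 subnn muln0 addn3; apply=> l lt.
    by rewrite size_nseq.
  apply: (@exec_le_seq _ _ _ (counts i j 0 (j ^ d - l.+1) (c * l) o) _ 1).
    by rewrite -(subnSK lt); apply: (exec_le_one (exec_pop RR _)).
  by rewrite mulnS; apply: exec_repeat_push_RT.
apply: exec_le_seq; first exact: exec_move_TR.
by rewrite [_ + c]addnC; apply: exec_repeat_push_RR.
Qed.

End Costs.

(** * The reduction *)

Lemma poly_compute_space_time c d f :
  poly f -> poly (fun n => compute_space_time c d (f n)).
Proof.
move=> fp; rewrite /compute_space_time.
have H k : poly (fun n => (f n ^ k * (f n * 12 + 5)).+1 + (f n ^ k * f n * 5).+1).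
  by polyb.
have := poly_sum d H; by move=> ?; polyb.
Qed.

Definition bit_token (b : bool) : token := if b then K1 else K0.

Lemma encode_bits s :
  encode_letter (bits s) = [seq bit_token b | b <- s] ++ [:: K1; Kend].
Proof. by elim: s => // -[] s /= <-. Qed.

Definition encode_axiom (AB : formula * formula) : seq token :=
  encode_formula AB.1 ++ Karrow :: encode_formula AB.2 ++ [:: Kcomma].

Lemma encode_instanceE P s : encode_instance (P, s) =
  flatten [seq encode_axiom AB | AB <- P] ++ Kturnstile :: encode_sequent s.
Proof.
rewrite /encode_instance /=; congr (flatten _ ++ _); apply: eq_map => AB.
by rewrite /encode_axiom /encode_sequent /= -catA.
Qed.

Section Reduction.

Variables (S : finType) (M : TM S) (c d : nat).

Notation column := (column M).
Notation sym := (sym S).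

(** [K0] is the unary digit of positions, so a constant prefix of [i] digits before the value of
    [RJ] names a neighbouring cell. *)
Definition cell_template (i : nat) (a : column) : template S :=
  text S (nseq i K0) ++ None ::
  text S (K1 :: [seq bit_token b | b <- onehot a] ++ [:: K1; Kend]).

Lemma instantiate_cell i j o a :
  instantiate j o (cell_template i a) = encode_formula (cell (i + j) a).
Proof.
rewrite instantiate_cat /= instantiate_text /instantiate /= -/(instantiate j o _).
rewrite instantiate_text encode_bits /cell_code map_cat map_nseq /= -!catA /=.
by rewrite nseqD -catA.
Qed.

Definition letter_of (o : option sym) : option S :=
  obind (fun a => if a is inl b then Some b else None) o.

(** Each one-hot bit is decided by the symbol under the head of the input tape; this is the template
    that looks at the input. *)
Definition init_template (head : bool) : template S :=
  text S (encode_formula init ++ [:: Karrow]) ++ None :: text S [:: K1]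
  ++ [seq Some (fun o => bit_token (b == initial_column M head (letter_of o)))
        | b <- enum column]
  ++ text S [:: K1; Kend; Kcomma].

Lemma instantiate_init head j o : instantiate j o (init_template head) =
  encode_axiom (init_axiom j (initial_column M head (letter_of o))).
Proof.
rewrite instantiate_cat instantiate_text -[None :: _]cat1s !instantiate_cat.
rewrite !instantiate_text /encode_axiom /init_axiom -catA /=.
rewrite encode_bits /cell_code map_cat map_nseq /= -!catA.
do 5!congr (_ :: _); congr (_ ++ _ :: _ ++ _).
by rewrite /instantiate /onehot; elim: (enum column) => //= b s ->.
Qed.

Definition border_template : template S :=
  text S [:: Ktop; Karrow] ++ cell_template 0 (blank_column M)
  ++ text S [:: Kcomma].

Lemma instantiate_border j o : instantiate j o border_template =
  encode_axiom (border_axiom (blank_column M) j).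
Proof.
by do 2!rewrite instantiate_cat ?instantiate_text ?instantiate_cell.
Qed.

Definition step_template (x : column * column * column * column) : template S :=
  let: (a, b, c, d) := x in
  text S (Kand :: encode_formula (cell 0 a) ++ [:: Kand]) ++ cell_template 0 b
  ++ text S [:: Kand] ++ cell_template 1 c ++ cell_template 2 d
  ++ text S [:: Karrow, Kunder & encode_formula tick]
  ++ cell_template 1 (next_column a b c d) ++ text S [:: Kcomma].

Lemma instantiate_step j o x : instantiate j o (step_template x) =
  encode_axiom (step_axiom (@next_column S M) j x).
Proof.
case: x => [[[a b] c'] d']; rewrite /step_template.
do 7!rewrite instantiate_cat ?instantiate_text ?instantiate_cell.
have E u v w y t (z : seq token) :
    (Kand :: u ++ [:: Kand]) ++ v ++ [:: Kand] ++ w ++ y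
      ++ (Karrow :: Kunder :: t) ++ z ++ [:: Kcomma]
    = (Kand :: u ++ Kand :: v ++ Kand :: w ++ y)
      ++ Karrow :: (Kunder :: t ++ z) ++ [:: Kcomma].
  by do 4!rewrite -?catA ?cat_cons.
exact: E.
Qed.

Definition steps_template : template S :=
  flatten [seq step_template x | x <- enum {: column * column * column * column}].

Lemma instantiate_steps j o : instantiate j o steps_template =
  flatten [seq encode_axiom AB | AB <- step_axioms (@next_column S M) j].
Proof.
rewrite instantiate_flatten -!map_comp; congr flatten.
by apply: eq_map => x /=; rewrite instantiate_step.
Qed.

Definition final_text : seq token :=
  flatten [seq encode_axiom AB
    | AB <- closing_axioms (@next_column0 S M) (@accepting_column S M)]
  ++ Kturnstile :: encode_sequent (leaf init, goal).

(* The cell [0] is written before the first loop, so that [RJ] holds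
   [maxn 1 (size x)] after it: [width] is therefore positive even for the empty
   input. *)
Definition program : cmd S :=
  Seq (emit_template (init_template true)) (Seq (Pop _ RI) (Seq (Push _ RJ)
  (Seq (While RI (Seq (emit_template (init_template false))
                   (Seq (Pop _ RI) (Push _ RJ))))
  (Seq (compute_space S c d)
  (Seq (While RR (Seq (Pop _ RR) (Seq (emit_template (init_template false))
                   (Push _ RJ))))
  (Seq (emit_template border_template) (Seq (Pop _ RJ)
  (Seq (While RJ (Seq (Pop _ RJ) (emit_template steps_template)))
       (emit_template (text S final_text)))))))))).

Definition init_column (x : seq S) (j : nat) : column :=
  initial_column M (j == 0) (onth x j).

(** The columns counted in [RJ] after reading the input, plus the space bound at that count, which
    dominates the bound at [n]. *)
Definition width (n : nat) : nat := n.-1.+1 + (c * n.-1.+1 ^ d + c).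

Definition reduction_instance (x : seq S) : instance :=
  (automaton_axioms (@next_column S M) (@next_column0 S M)
     (@accepting_column S M) (blank_column M) (init_column x) (width (size x)),
   (leaf init, goal)).

Definition init_text (x : seq S) (m n : nat) : seq token :=
  flatten [seq encode_axiom (init_axiom j (init_column x j)) | j <- iota m n].

Definition steps_text (l : seq nat) : seq token :=
  flatten [seq flatten [seq encode_axiom AB
                         | AB <- step_axioms (@next_column S M) j] | j <- l].

Lemma encode_reduction_instance x : encode_instance (reduction_instance x) =
  init_text x 0 (width (size x))
  ++ encode_axiom (border_axiom (blank_column M) (width (size x)))
  ++ steps_text (rev (iota 0 (width (size x)).-1)) ++ final_text.
Proof.
rewrite encode_instanceE; move: (width _) => w.
have Econs b P t : flatten [seq encode_axiom AB | AB <- b :: P] ++ t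
    = encode_axiom b ++ flatten [seq encode_axiom AB | AB <- P] ++ t.
  by rewrite catA.
rewrite /automaton_axioms map_cat flatten_cat -catA; congr (_ ++ _).
  by rewrite -map_comp.
rewrite Econs map_cat flatten_cat -catA; congr (_ ++ (_ ++ _)).
rewrite /steps_text; elim: (rev _) => //= j l <-.
by rewrite map_cat flatten_cat.
Qed.

(** * Output and running time of the printing program *)

Lemma init_textS x m n : init_text x m n.+1 =
  init_text x m n ++ encode_axiom (init_axiom (m + n) (init_column x (m + n))).
Proof. by rewrite /init_text -addn1 iotaD map_cat flatten_cat /= cats0. Qed.

(** The nesting of the sum follows that of [Seq] in [program]; inside the last three loops or
    emissions that use [RJ], its value is bounded by [width n]. *)
Definition program_time (n : nat) : nat :=
  let j := n.-1.+1 in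
  let r := c * j ^ d + c in
  let t l i := size l * (11 * i + 2) in
  t (init_template true) 0 + (1 + (2 +
  ((n.-1 * (t (init_template false) j + (1 + 2)).+2).+1 +
  (compute_space_time c d j +
  ((r * (1 + (t (init_template false) (width n) + 2)).+2).+1 +
  (t border_template (width n) + (1 +
  (((width n).-1 * (1 + t steps_template (width n)).+2).+1 +
   t (text S final_text) 0)))))))).

Lemma poly_program_time : poly program_time.
Proof.
have pj : poly (fun n => n.-1.+1).
  by apply: poly_le (poly_succ poly_id) => n; rewrite ltnS leq_pred.
have pp : poly (fun n => n.-1) by apply: poly_le poly_id => n; rewrite leq_pred.
have pw : poly width by rewrite /width; polyb.
have pwp : poly (fun n => (width n).-1).
  by apply: poly_le pw => n; rewrite leq_pred.
have pc := poly_compute_space_time c d pj.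
by rewrite /program_time; polyb.
Qed.

Definition input_store (x : seq S) : store S :=
  counts [seq inl a | a <- x] 0 0 0 0 [::].

Lemma exec_read_input x o :
  exec_le (While RI (Seq (emit_template (init_template false))
                      (Seq (Pop _ RI) (Push _ RJ))))
    (counts [seq inl a | a <- behead x] 1 0 0 0 o)
    (counts [::] (size x).-1.+1 0 0 0 (o ++ init_text x 1 (size x).-1))
    ((size x).-1 * (size (init_template false) * (11 * (size x).-1.+1 + 2)
                    + (1 + 2)).+2).+1.
Proof.
pose sigma k := counts (drop k [seq inl a | a <- behead x]) k.+1 0 0 0
                  (o ++ init_text x 1 k).
have := @exec_le_while_up _ RI _ sigma (size x).-1 _ _.
rewrite {4 5}/sigma drop0 cats0 drop_oversize ?size_map ?size_behead //.
apply=> k kn.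
  by rewrite size_drop size_map size_behead.
apply: exec_le_seq.
  apply: exec_le_leq (exec_emit_template _ _ _ _ _ _) _.
  by rewrite leq_mul2l; apply/orP; right; lia.
rewrite instantiate_init /sigma init_textS catA add1n.
(* The shift by one accounts for the first letter, already consumed with column 0. *)
have -> : letter_of (ohead (drop k [seq inl a | a <- behead x])) = onth x k.+1.
  case: (x) => [|a y] /=; first by [].
  by elim: y {kn} k => [|b y IH] [|k] //=.
have -> : drop k.+1 [seq inl a | a <- behead x]
    = behead (drop k [seq inl a | a <- behead x] : seq sym).
  by rewrite -[behead (drop _ _)]drop1 drop_drop add1n.
apply: exec_le_seq; first exact: (exec_le_one (exec_pop RI _)).
exact: (exec_le_two (exec_push RJ _)).
Qed.

(** Past the input its tape reads blank, which agrees with [onth x] from [size x] on. *)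
Lemma exec_pad x o j r w : size x <= j -> 0 < j -> j + r <= w ->
  exec_le (While RR (Seq (Pop _ RR) (Seq (emit_template (init_template false))
                      (Push _ RJ))))
    (counts [::] j 0 r 0 o) (counts [::] (j + r) 0 0 0 (o ++ init_text x j r))
    (r * (1 + (size (init_template false) * (11 * w + 2) + 2)).+2).+1.
Proof.
move=> xj j0 jw.
pose sigma k : store S := counts [::] (j + k) 0 (r - k) 0 (o ++ init_text x j k).
have := @exec_le_while_up S RR _ sigma r _ _.
rewrite {4 5}/sigma subn0 subnn addn0 cats0; apply=> k kr.
  by rewrite size_nseq.
apply: (@exec_le_seq _ _ _ _
  (counts [::] (j + k) 0 (r - k.+1) 0 (o ++ init_text x j k))).
  by rewrite /sigma -(subnSK kr); apply: (exec_le_one (exec_pop RR _)).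
apply: exec_le_seq.
  apply: exec_le_leq (exec_emit_template _ _ _ _ _ _) _.
  by rewrite leq_mul2l; apply/orP; right; lia.
rewrite instantiate_init /sigma init_textS catA addnS.
have <- : init_column x (j + k) = initial_column M false (letter_of (ohead [::])).
  congr initial_column; first by lia.
  by rewrite onth_default //; lia.
exact: (exec_le_two (exec_push RJ _)).
Qed.

(** Each round pops before printing, so the values [n.-1] down to 0 are printed. *)
Lemma exec_steps n o w : n <= w ->
  exec_le (While RJ (Seq (Pop _ RJ) (emit_template steps_template)))
    (counts [::] n 0 0 0 o)
    (counts [::] 0 0 0 0 (o ++ steps_text (rev (iota 0 n))))
    (n * (1 + size steps_template * (11 * w + 2)).+2).+1.
Proof.
move=> nw.
pose sigma k : store S :=
  counts [::] k 0 0 0 (o ++ steps_text (rev (iota k (n - k)))).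
have := @exec_le_while S RJ _ sigma n _ _.
rewrite {4 5}/sigma subn0 subnn cats0; apply=> k kn; first by rewrite size_nseq.
apply: (@exec_le_seq _ _ _ _
  (counts [::] k 0 0 0 (o ++ steps_text (rev (iota k.+1 (n - k.+1)))))).
  exact: (exec_le_one (exec_pop RJ _)).
rewrite /sigma -(subnSK kn) /= rev_cons /steps_text map_rcons flatten_rcons catA.
rewrite -(instantiate_steps k (ohead [::])).
apply: exec_le_leq (exec_emit_template _ _ _ _ _ _) _.
by rewrite leq_mul2l; apply/orP; right; lia.
Qed.

Lemma exec_program x : exists2 s,
  exec_le program (input_store x) s (program_time (size x))
  & out s = encode_instance (reduction_instance x).
Proof.
rewrite encode_reduction_instance; set w := width _.
have w0 : 0 < w by [].
exists (counts [::] 0 0 0 0 (init_text x 0 w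
  ++ encode_axiom (border_axiom (blank_column M) w)
  ++ steps_text (rev (iota 0 w.-1)) ++ final_text)) => //.
apply: exec_le_seq; first exact: exec_emit_template.
have -> : instantiate 0 (ohead [seq inl a | a <- x]) (init_template true)
    = init_text x 0 1.
  by rewrite instantiate_init /init_text /= cats0; case: (x).
rewrite cat0s; pose i : seq sym := [seq inl a | a <- behead x].
apply: (@exec_le_seq _ _ _ _ (counts i 0 0 0 0 (init_text x 0 1))).
  have -> : i = behead [seq inl a | a <- x] by rewrite behead_map.
  exact: (exec_le_one (exec_pop RI _)).
apply: (@exec_le_seq _ _ _ _ (counts i 1 0 0 0 (init_text x 0 1))).
  exact: (exec_le_two (exec_push RJ _)).
apply: exec_le_seq; first exact: exec_read_input.
apply: exec_le_seq; first exact: exec_compute_space.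
apply: exec_le_seq; first by apply: (@exec_pad x _ _ _ w) => //; lia.
apply: exec_le_seq; first exact: exec_emit_template.
(* The border was printed at position [w]; the countdown over step axioms starts from [w.-1]. *)
apply: exec_le_seq; first exact: (exec_le_one (exec_pop RJ _)).
apply: exec_le_seq; first by apply: (@exec_steps w.-1 _ w); rewrite leq_pred.
rewrite instantiate_border.
rewrite -/(width (size x)) -/w.
(* Column 0, the rest of the input and the padding are printed in turn; their texts join into one
   interval of positions. *)
have init_textD m a b :
    init_text x m a ++ init_text x (m + a) b = init_text x m (a + b).
  by rewrite /init_text iotaD map_cat flatten_cat.
rewrite (init_textD 0 1) (init_textD 0) -/(width (size x)) -/w.
move: (init_text x 0 w) (encode_axiom _) (steps_text _) => u v t.
have := exec_emit_template (text S final_text) [::] 0 0 0 ((u ++ v) ++ t).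
by rewrite instantiate_text !catA.
Qed.

Definition reduction (x : seq S) : seq token :=
  encode_instance (reduction_instance x).

Lemma reduction_polytime : polytime reduction.
Proof.
have [a [b tB]] := poly_bound poly_program_time.
exists (machine (compile 0 program)), inr, a, b; split=> [k l []//|x].
have [s [n nt ex] outs] := exec_program x; exists n.
have [hn outE] := machine_run ex; rewrite outs in outE.
by split=> //; apply: leq_trans nt (tB _).
Qed.

(** * Correctness of the reduction *)

Section Correctness.

Variable x : seq S.
Hypothesis bounded : forall n, space (run M n x) <= c * size x ^ d + c.

Let gamma (t j : nat) : column := column_at (run M t x) j.

Let width_gt0 : 0 < width (size x). Proof. by []. Qed.

Let gamma0 t : gamma t.+1 0 = next_column0 (gamma t 0) (gamma t 1).
Proof. exact: next_column0_step. Qed.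

Let gammaS t j : gamma t.+1 j.+1 =
  next_column (gamma t 0) (gamma t j) (gamma t j.+1) (gamma t j.+2).
Proof. exact: next_column_step. Qed.

Let gamma_width t : gamma t (width (size x)) = blank_column M.
Proof.
apply: column_at_space => //; apply: leq_trans (bounded t) _.
apply: leq_trans (leq_addl _ _); rewrite leq_add2r leq_mul2l.
by case: d => [|d']; rewrite ?orbT // leq_exp2r // leqSpred orbT.
Qed.

Let instanceE : reduction_instance x =
  (automaton_axioms (@next_column S M) (@next_column0 S M)
     (@accepting_column S M) (blank_column M) (gamma 0) (width (size x)),
   (leaf init, goal)).
Proof.
rewrite /reduction_instance /automaton_axioms; congr (_ ++ _, _).
by apply: eq_map => j; rewrite /gamma column_at_initial.
Qed.

(** An accepting column at any time belongs to a halted configuration, and this is the one at which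
    acceptance means [P]. *)
Lemma reduction_correct (P : Prop) :
  (exists n, halted (run M n x) /\ (accept (run M n x).1 <-> P)) ->
  P <-> consequence (reduction_instance x).
Proof.
case=> n [hn accP]; rewrite instanceE; split=> [/accP an|].
  apply: (@accepting_consequence _ _ _ _ _ _ _ width_gt0 gamma0 gammaS gamma_width n).
  by rewrite accepting_column_at an.
case: (boolP (accept (run M n x).1)) => [/accP //|nan] der.
case: (rejecting_consequence gamma0 gammaS gamma_width _ der) => t.
rewrite accepting_column_at; apply: contra nan => /andP[at_ ht].
by rewrite (halted_run_eq hn ht).
Qed.

End Correctness.

End Reduction.

Theorem theorem7 : PSPACE_hard consequence_problem.
Proof.
move=> S L [M [c [d HM]]]; exists (reduction M c d).
  exact: reduction_polytime.
move=> x; have [bounded dec] := HM x.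
rewrite (reduction_correct bounded dec).
(* The printed word determines its instance, so membership in the language speaks of the constructed
   instance. *)
split=> [|[I /encode_instance_inj <-]] //.
by exists (reduction_instance M c d x).
Qed.
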